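(* Let $H\in(\tfrac12,1)$, let $B^H$ be a one-dimensional fractional Brownian motion with Hurst parameter $H$, let $X_0\in\mathbb{R}\setminus\{0\}$ be a constant, and let $\kappa\ge 2H$, $\lambda,\mu\in\mathbb{R}$ satisfy either (a) $\kappa>2H$ and $\lambda>0$, or (b) $\kappa=2H$ and $-\lambda+\mu^2<0$. Consider the test equation $dX(t)=-\lambda\kappa t^{\kappa-1}X(t)\,dt+\mu X(t)\,dB^H(t)$, $X(0)=X_0$. For a fixed step size $\Delta t>0$ and a parameter $\theta$, put $t_n=n\Delta t$ and $V_n^H=B^H(t_{n+1})-B^H(t_n)$, and let $(X_n)_{n\ge0}$ be the stochastic theta method (STM) approximation started at $X_0$ and defined by $$X_{n+1}=X_n-\kappa\lambda\theta\, t_{n+1}^{\kappa-1}X_{n+1}\,\Delta t-\kappa\lambda(1-\theta)\,t_n^{\kappa-1}X_n\,\Delta t+\mu X_nV_n^H,\qquad n\ge0.$$ Then: (i) If $\kappa\ge 2H$ and $\frac{\sqrt{3/2}\,e}{\sqrt{3/2}\,e+1}\le\theta\le1$, then the STM is mean square stable, i.e. $\lim_{n\to\infty}\mathbb{E}|X_n|^2=0$ (for every fixed $\Delta t>0$). (ii) If $\kappa>3/2$ and $\frac12<\theta\le1$, then the STM is mean square stable, i.e. $\lim_{n\to\infty}\mathbb{E}|X_n|^2=0$ (for every fixed $\Delta t>0$). (iii) If $\kappa\ge2H$ and $0<\theta<\frac12$, then the STM is not unconditionally mean square stable, i.e. it is not the case that $\lim_{n\to\infty}\mathbb{E}|X_n|^2=0$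 for every step size $\Delta t>0$.
   Context: A fractional Brownian motion with Hurst parameter $H$ is a centered Gaussian process $(B^H(t))_{t\ge0}$ with covariance $\mathbb{E}[B^H(t)B^H(s)]=\frac12\left(t^{2H}+s^{2H}-|t-s|^{2H}\right)$. Since $\lambda>0$ under (a) or (b), the implicit recursion is uniquely solvable: $$X_{n+1}=\frac{1-\kappa(1-\theta)\lambda t_n^{\kappa-1}\Delta t+\mu V_n^H}{1+\kappa\theta\lambda t_{n+1}^{\kappa-1}\Delta t}\,X_n .$$ Conditions (a)/(b) are those under which the exact solution $X(t)=X_0\exp(-\lambda t^\kappa+\mu B^H(t))$ satisfies $\lim_{t\to\infty}\mathbb{E}|X(t)|^2=0$. ''Unconditionally'' refers to the step size: unconditional stability means that the numerical method preserves the stability of the test equation with no restriction on $\Delta t>0$. *)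

(* Defs.v *)
From HB Require Import structures.
From mathcomp Require Import all_boot all_order all_algebra.
From mathcomp Require Import all_classical all_reals all_analysis.
Set Implicit Arguments.
Unset Strict Implicit.
Unset Printing Implicit Defensive.
Import Order.TTheory GRing.Theory Num.Theory.
Import numFieldNormedType.Exports.
Local Open Scope classical_set_scope.
Local Open Scope ring_scope.

(* Constants count as Gaussian. They are treated separately because the
   library's [normal_prob m 0] is the uniform law on [0, 1], not [\d_m]. *)
Definition gaussian_rv (d : measure_display) (T : measurableType d)
    (R : realType) (P : probability T R) (X : T -> R) : Prop :=
  exists m : R,
    (forall A : set R, measurable A -> pushforward P X A = \d_m A) \/
    (exists2 s : R, 0 < s &
      forall A : set R, measurable A -> pushforward P X A = normal_prob m s A).

(* Processes on [0, +oo) are indexed by all of R; their values at negative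
   times are unconstrained. *)
Definition gaussian_process (d : measure_display) (T : measurableType d)
    (R : realType) (P : probability T R) (B : R -> {RV P >-> R}) : Prop :=
  forall (n : nat) (t c : 'I_n -> R), (forall i, 0 <= t i) ->
    gaussian_rv P (fun w => \sum_(i < n) c i * B (t i) w).

Definition fractional_brownian_motion (d : measure_display)
    (T : measurableType d) (R : realType) (P : probability T R)
    (H : R) (B : R -> {RV P >-> R}) : Prop :=
  [/\ gaussian_process B,
      forall t : R, 0 <= t -> ('E_P[B t] = 0)%E &
      forall t s : R, 0 <= t -> 0 <= s ->
        ('E_P[fun w => (B t w * B s w)%R] =
         (2^-1 * (t `^ (2 * H) + s `^ (2 * H) - `|t - s| `^ (2 * H)))%:E)%E].

Definition theta_method (d : measure_display) (T : measurableType d)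
    (R : realType) (P : probability T R) (B : R -> {RV P >-> R})
    (X0 kappa lambda mu theta dt : R) (X : nat -> {RV P >-> R}) : Prop :=
  let t (n : nat) : R := n%:R * dt in
  (forall w, X 0%N w = X0) /\
  forall (n : nat) w,
    X n.+1 w = X n w
      - kappa * lambda * theta * t n.+1 `^ (kappa - 1) * X n.+1 w * dt
      - kappa * lambda * (1 - theta) * t n `^ (kappa - 1) * X n w * dt
      + mu * X n w * (B (t n.+1) w - B (t n) w).

(* The recursion is implicit, so the scheme is a predicate on [X]; it has
   exactly one solution when kappa, lambda, theta and dt are positive. *)
Definition mean_square_stable (d : measure_display) (T : measurableType d)
    (R : realType) (P : probability T R) (B : R -> {RV P >-> R})
    (X0 kappa lambda mu theta dt : R) : Prop :=
  forall X : nat -> {RV P >-> R},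
    theta_method B X0 kappa lambda mu theta dt X ->
    ('E_P[fun w => (`|X n w| ^+ 2)%R] @[n --> \oo] --> 0)%E.

Definition unconditionally_mean_square_stable (d : measure_display)
    (T : measurableType d) (R : realType) (P : probability T R)
    (B : R -> {RV P >-> R}) (X0 kappa lambda mu theta : R) : Prop :=
  forall dt : R, 0 < dt -> mean_square_stable B X0 kappa lambda mu theta dt.

(* Main.v *)
Require Import Defs.
From HB Require Import structures.
From mathcomp Require Import all_boot all_order all_algebra.
From mathcomp Require Import all_classical all_reals all_analysis.
From mathcomp Require Import measurable_realfun ring lra.
Set Implicit Arguments.
Unset Strict Implicit.
Unset Printing Implicit Defensive.
Import Order.TTheory GRing.Theory Num.Theory.
Import numFieldNormedType.Exports.
Local Open Scope classical_set_scope.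
Local Open Scope ring_scope.

(** The scheme multiplies [X n] by [(A n + mu V n) / D n], where
    [A n] and [D n] grow like [t n `^ (kappa - 1)] and [A n / D n] tends to
    [- (1 - theta) / theta]; so [theta = 1/2] is the threshold.

    For [theta > 1/2], [(A + mu V)^2 <= max (A^2 / w) M * cosh (s V)] with
    [s^2] of order [1 / M], and a product of hyperbolic cosines is the average
    over signs of exponentials of [s (+- V 0 +- ... +- V (n-1))]. Since [H > 1/2]
    the increments are nonnegatively correlated, so the variance of each signed
    sum is at most [t n `^ (2 H)], and with [M] of order [t n `^ (2 (kappa - 1))]
    the expectation is [expR (o(n))], because [2 H - 2 (kappa - 1) < 1]. The
    deterministic factor decays geometrically. This covers both stability
    ranges of the theorem.

    For [theta < 1/2] and large step size, each factor with [n > 0] is,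
    in absolute value, at least [g (t n / t (n+1)) `^ (kappa - 1)] for a fixed
    [g > 1], unless [mu V n] is of the order of [A n]; with a union bound over
    the Gaussian tails and the symmetry of [V 0], [X n ^ 2] stays above a
    positive constant with probability at least [1/4]. *)

(** * Centered Gaussian variables *)

Section normal_law.
Context {R : realType}.
Local Notation mu := (@lebesgue_measure R).
Local Open Scope ereal_scope.

(** The Radon-Nikodym derivative of [normal_prob m s] and [normal_pdf m s] have the same integral
    over every measurable set, so they agree almost everywhere. *)
Lemma ge0_integral_normal_prob (m s : R) (f : R -> \bar R) :
  measurable_fun [set: R] f -> (forall x, 0 <= f x) ->
  \int[normal_prob m s]_x f x = \int[mu]_x (f x * (normal_pdf m s x)%:E).
Proof.
move=> mf f0.
have dom : normal_prob m s `<< mu := normal_prob_dominates m s.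
rewrite -(Radon_Nikodym_SigmaFinite.change_of_variables dom)//.
have mpdf : measurable_fun [set: R] (EFin \o normal_pdf m s).
  by apply/measurable_EFinP; exact: measurable_normal_pdf.
have irn := Radon_Nikodym_SigmaFinite.f_integrable dom.
apply: ae_eq_integral => //.
- by apply: emeasurable_funM => //; exact: measurable_int irn.
- exact: emeasurable_funM.
- apply: ae_eqe_mul2l; apply: integral_ae_eq => //.
  by move=> A _ mA; rewrite -Radon_Nikodym_SigmaFinite.f_integral.
Qed.

(** Completing the square: the weight [expR (a * x)] turns the density of mean [m] into a constant
    times that of mean [m + a * s ^+ 2]. *)
Lemma normal_mgf (m s a : R) : (0 < s)%R ->
  \int[normal_prob m s]_x (expR (a * x))%:E =
  (expR (a * m + a ^+ 2 * s ^+ 2 / 2))%:E.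
Proof.
move=> s0; have sN0 : s != 0%R by rewrite gt_eqF.
rewrite ge0_integral_normal_prob; last 2 first.
- by apply/measurable_EFinP; apply: measurableT_comp => //; exact: measurable_funM.
- by move=> x; rewrite lee_fin expR_ge0.
transitivity (\int[mu]_x ((expR (a * m + a ^+ 2 * s ^+ 2 / 2))%:E *
    (normal_pdf (m + a * s ^+ 2) s x)%:E)).
  apply: eq_integral => x _; rewrite -!EFinM !normal_pdfE//; congr EFin.
  rewrite mulrCA [RHS]mulrCA; congr *%R.
  by rewrite /normal_fun -!expRD; congr expR; field.
rewrite ge0_integralZl//; first by rewrite integral_normal_pdf mule1.
- by apply/measurable_EFinP; exact: measurable_normal_pdf.
- by move=> x _; rewrite lee_fin normal_pdf_ge0.
Qed.

(** The weight is tuned to turn the density of deviation [s] into that of the smaller deviation [t];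
    what remains is [t / s], the ratio of the two peaks. *)
Lemma normal_square_laplace (s t : R) : (0 < t)%R -> (t < s)%R ->
  \int[normal_prob 0%R s]_x
    (expR (- ((t ^- 2 - s ^- 2) / 2 * x ^+ 2)))%:E = (t / s)%:E.
Proof.
move=> t0 ts; have s0 : (0 < s)%R by rewrite (lt_trans t0).
have sN0 : s != 0%R by rewrite gt_eqF.
have tN0 : t != 0%R by rewrite gt_eqF.
rewrite ge0_integral_normal_prob; last 2 first.
- apply/measurable_EFinP; apply: measurableT_comp => //.
  by apply: measurableT_comp => //; apply: measurable_funM => //; exact: measurable_funX.
- by move=> x; rewrite lee_fin expR_ge0.
transitivity (\int[mu]_x ((t / s)%:E * (normal_pdf 0%R t x)%:E)).
  apply: eq_integral => x _; rewrite -!EFinM !normal_pdfE//; congr EFin.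
  rewrite mulrCA [RHS]mulrA /normal_fun -expRD.
  have -> : (normal_peak s = t / s * normal_peak t)%R.
    rewrite /normal_peak -!mulrnAr (sqrtrM _ (sqr_ge0 s)) (sqrtrM _ (sqr_ge0 t)).
    rewrite !sqrtr_sqr !gtr0_norm//.
    rewrite !invfM; field.
    by rewrite sN0 tN0 gt_eqF// sqrtr_gt0 pmulrn_rgt0// pi_gt0.
  by congr (_ * expR _)%R; field; rewrite sN0 tN0.
rewrite ge0_integralZl//; first by rewrite integral_normal_pdf mule1.
- by apply/measurable_EFinP; exact: measurable_normal_pdf.
- by move=> x _; rewrite lee_fin normal_pdf_ge0.
- by rewrite lee_fin divr_ge0 ?ltW.
Qed.

Lemma normal_prob_half (s : R) : (0 < s)%R ->
  (2^-1)%:E <= normal_prob 0%R s `[0%R, +oo[.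
Proof.
move=> s0; have sN0 : s != 0%R by rewrite gt_eqF.
have mpdf : measurable_fun [set: R] (EFin \o normal_pdf 0%R s).
  by apply/measurable_EFinP; exact: measurable_normal_pdf.
have pdf0 x : 0 <= (EFin \o normal_pdf 0%R s) x.
  by rewrite lee_fin normal_pdf_ge0.
have sym : normal_prob 0%R s `[0%R, +oo[ = normal_prob 0%R s `]-oo, 0%R].
  rewrite /normal_prob (@ge0_integration_by_substitution0 _ (EFin \o normal_pdf 0%R s))//=.
  apply: eq_integral => x _; congr EFin.
  by rewrite !normal_pdfE// /normal_fun !subr0 sqrrN.
have : 1 <= normal_prob 0%R s `[0%R, +oo[ + normal_prob 0%R s `]-oo, 0%R].
  rewrite -[leLHS](@probability_setT _ _ _ (normal_prob 0%R s)).
  apply: le_trans (measureU2 _ _ _) => //.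
  apply: le_measure; rewrite ?inE//; first exact: measurableU.
  by move=> x _ /=; rewrite !in_itv/= andbT; case: (leP 0%R x) => [|/ltW]; [left|right].
rewrite -sym; case: (normal_prob _ _ _) (measure_ge0 (normal_prob 0%R s) `[0%R, +oo[) => [p| |] //.
- by rewrite -EFinD !lee_fin => _; lra.
- by move=> _ _; exact: leey.
Qed.

End normal_law.

Section gaussian.
Context d (T : measurableType d) (R : realType) (P : probability T R).
Local Open Scope ereal_scope.

(* [R] and [measurableTypeR R] have the same measurable sets but different
   displays; [normal_prob] is a measure on the latter only. *)
Lemma ge0_integral_law (L : T -> R) (nu : {measure set (measurableTypeR R) -> \bar R})
    (f : R -> \bar R) :
  measurable_fun [set: T] L ->
  (forall A : set R, measurable A -> pushforward P L A = nu A) ->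
  measurable_fun [set: R] f -> (forall x, 0 <= f x) ->
  \int[P]_w f (L w) = \int[nu]_x f x.
Proof.
move=> mL law mf f0.
transitivity (\int[pushforward P (L : T -> measurableTypeR R)]_x f x).
  by rewrite (@ge0_integral_pushforward _ _ _ (measurableTypeR R)).
apply: eq_measure_integral => A mA _; exact: law.
Qed.

Lemma measurable_expRM (a : R) :
  measurable_fun [set: R] (fun x : R => (expR (a * x))%:E).
Proof.
by apply/measurable_EFinP; apply: measurableT_comp => //; exact: measurable_funM.
Qed.

(** Integrate [1 + y <= expR y] at [y = a * L w]; an infinite integral satisfies the bound
    trivially. *)
Lemma centered_mgf_ge1 (L : T -> R) (a : R) :
  P.-integrable [set: T] (EFin \o L) -> \int[P]_w (L w)%:E = 0 ->
  1 <= \int[P]_w (expR (a * L w))%:E.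
Proof.
move=> iL L0; have mL : measurable_fun [set: T] L.
  by apply/measurable_EFinP; exact: measurable_int iL.
have [->|fin] := eqVneq (\int[P]_w (expR (a * L w))%:E) +oo; first exact: leey.
have iaL : P.-integrable [set: T] (fun w => a%:E * (L w)%:E).
  exact: integrableZl.
have i1 : P.-integrable [set: T] (cst 1).
  exact: finite_measure_integrable_cst.
have <- : \int[P]_w (cst 1 w + a%:E * (L w)%:E) = 1.
  rewrite integralD// integralZl// L0 mule0 adde0.
  by rewrite integral_cst//= mul1e probability_setT.
apply: le_integral => //.
- exact: integrableD.
- apply/integrableP; split.
    by apply/measurable_EFinP; apply: measurableT_comp => //; exact: measurable_funM.
  under eq_integral do rewrite gee0_abs ?lee_fin ?expR_ge0//.
  by rewrite ltey.
- by move=> w _; rewrite /= -EFinM -EFinD lee_fin expR_ge1Dx.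
Qed.

(** A nonzero mean parameter [m] would push the moment generating function below 1 at [- m] (Dirac
    case) or at its minimiser [- m / s ^+ 2] (normal case), against [centered_mgf_ge1]. *)
Lemma centered_gaussian_law (L : T -> R) :
    P.-integrable [set: T] (EFin \o L) -> \int[P]_w (L w)%:E = 0 ->
    gaussian_rv P L ->
  (forall A : set R, measurable A -> pushforward P L A = \d_(0%R : R) A) \/
  exists2 s : R, (0 < s)%R &
    forall A : set R, measurable A -> pushforward P L A = normal_prob 0%R s A.
Proof.
move=> iL L0 [m law]; have mL : measurable_fun [set: T] L.
  by apply/measurable_EFinP; exact: measurable_int iL.
have ge1 := fun a => centered_mgf_ge1 a iL L0.
case: law => [law|[s s0 law]]; [left|right; exists s => //].
- suff -> : 0%R = m by [].
  have : 1 <= (expR (- m * m))%:E.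
    rewrite (le_trans (ge1 (- m)%R))//.
    rewrite (@ge0_integral_law _ (\d_(m : measurableTypeR R)) _ mL law (measurable_expRM (- m)))//.
    rewrite integral_dirac ?diracT ?mul1e//; exact: measurable_expRM.
  rewrite lee_fin -[leLHS]expR0 ler_expR mulNr -expr2 oppr_ge0 => m2.
  by apply/esym/eqP; rewrite -sqrf_eq0 eq_le m2 sqr_ge0.
- suff -> : 0%R = m by [].
  have sN0 : s != 0%R by rewrite gt_eqF.
  have : 1 <= (expR (- (m / s) ^+ 2 / 2))%:E.
    rewrite (le_trans (ge1 (- m / s ^+ 2)%R))//.
    rewrite (@ge0_integral_law _ (normal_prob m s) _ mL law (measurable_expRM _))//.
    by rewrite normal_mgf// lee_fin ler_expR le_eqVlt; apply/orP; left; apply/eqP; field.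
  rewrite lee_fin -[leLHS]expR0 ler_expR mulNr oppr_ge0 pmulr_lle0// => m2.
  have /eqP : ((m / s) ^+ 2 == 0)%R by rewrite eq_le m2 sqr_ge0.
  move=> /eqP; rewrite sqrf_eq0 mulf_eq0 invr_eq0 (negbTE sN0) orbF => /eqP.
  by move->.
Qed.

(** The bound is on the second moment, whereas the law comes with its own deviation [s]; the point
    is [s ^+ 2 <= v]. *)
Lemma centered_gaussian_mgf_le (L : T -> R) (v a : R) :
    P.-integrable [set: T] (EFin \o L) -> \int[P]_w (L w)%:E = 0 ->
    gaussian_rv P L -> \int[P]_w (L w ^+ 2)%:E <= v%:E ->
  \int[P]_w (expR (a * L w))%:E <= (expR (a ^+ 2 * v / 2))%:E.
Proof.
move=> iL L0 gL L2; have mL : measurable_fun [set: T] L.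
  by apply/measurable_EFinP; exact: measurable_int iL.
have v0 : (0 <= v)%R.
  by rewrite -lee_fin (le_trans _ L2)// integral_ge0// => w _; rewrite lee_fin sqr_ge0.
have [law|[s s0 law]] := centered_gaussian_law iL L0 gL.
  rewrite (@ge0_integral_law _ (\d_(0%R : measurableTypeR R)) _ mL law (measurable_expRM a))//.
  rewrite integral_dirac ?diracT ?mul1e ?mulr0 ?lee_fin ?ler_expR//; last first.
    exact: measurable_expRM.
  by apply: divr_ge0 => //; apply: mulr_ge0 => //; exact: sqr_ge0.
rewrite (@ge0_integral_law _ (normal_prob 0%R s) _ mL law (measurable_expRM a))//.
rewrite normal_mgf// lee_fin ler_expR mulr0 add0r ler_wpM2r ?invr_ge0//.
rewrite ler_wpM2l ?sqr_ge0//.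
(* [1 - y <= exp (- y)] bounds the second moment from below by a Laplace
   transform, whose value determines [s]. *)
have key t : (0 < t)%R -> (t < s)%R -> (t ^+ 2 <= v)%R.
  move=> t0 ts; set c := ((t ^- 2 - s ^- 2) / 2)%R.
  have c0 : (0 < c)%R.
    rewrite divr_gt0// subr_gt0 ltf_pV2 ?posrE ?exprn_gt0//.
    by rewrite ltr_pXn2r// nnegrE ltW.
  have mg : measurable_fun [set: R] (fun x : R => (expR (- (c * x ^+ 2)))%:E).
    apply/measurable_EFinP; apply: measurableT_comp => //.
    by apply: measurableT_comp => //; apply: measurable_funM => //; exact: measurable_funX.
  have : 1 <= c%:E * v%:E + (t / s)%:E.
    rewrite -(normal_square_laplace t0 ts) -(@ge0_integral_law _ (normal_prob 0%R s) _ mL law mg)//.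
    apply: (@le_trans _ _ (c%:E * \int[P]_w (L w ^+ 2)%:E +
        \int[P]_w (expR (- (c * L w ^+ 2)))%:E)); last first.
      by rewrite leeD2r// lee_pmul2l.
    rewrite -ge0_integralZl//; last 3 first.
    - by apply/measurable_EFinP; exact: measurable_funX.
    - by move=> w _; rewrite lee_fin sqr_ge0.
    - by rewrite lee_fin ltW.
    have -> : 1 = \int[P]_w (cst 1 w).
      by rewrite integral_cst//= mul1e probability_setT.
    rewrite -ge0_integralD//; last 3 first.
    - by move=> w _; rewrite mule_ge0 ?lee_fin ?sqr_ge0 ?ltW.
    - by apply: emeasurable_funM => //; apply/measurable_EFinP; exact: measurable_funX.
    - exact: (measurableT_comp mg).
    apply: ge0_le_integral => //.
    - apply: emeasurable_funD.
        by apply: emeasurable_funM => //; apply/measurable_EFinP; exact: measurable_funX.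
      exact: (measurableT_comp mg).
    - move=> w _; rewrite -EFinM -EFinD lee_fin.
      have := expR_ge1Dx (- (c * L w ^+ 2)); lra.
  rewrite -EFinM -EFinD lee_fin => cv.
  have {}cv : (1 - t / s <= c * v)%R by lra.
  (* Both sides of [cv] carry the factor [1 - t / s]; once it is cancelled, [(1 + t / s) / 2 <= 1]
     leaves [t ^+ 2 <= v]. *)
  have cE : (c = (1 - t / s) * ((1 + t / s) / (2 * t ^+ 2)))%R.
    by rewrite /c; field; rewrite !gt_eqF.
  have ts1 : (0 < 1 - t / s)%R by rewrite subr_gt0 ltr_pdivrMr// mul1r.
  move: cv; rewrite cE -mulrA -[leLHS]mulr1 ler_pM2l// => cv.
  have ts1' : (t / s < 1)%R by lra.
  have : (1 <= v / t ^+ 2)%R.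
    apply: le_trans cv _.
    have -> : ((1 + t / s) / (2 * t ^+ 2) * v = (1 + t / s) / 2 * (v / t ^+ 2))%R.
      by field; rewrite !gt_eqF.
    by rewrite ler_piMl ?divr_ge0 ?sqr_ge0//; lra.
  by rewrite ler_pdivlMr ?exprn_gt0// mul1r.
(* If [v < s ^+ 2], the midpoint of [Num.sqrt v] and [s] is an admissible [t] whose square exceeds
   [v]. *)
rewrite leNgt; apply/negP => vs.
have sv : (Num.sqrt v < s)%R.
  by rewrite -(ltr_pXn2r (n := 2))// ?nnegrE ?sqrtr_ge0 ?ltW// sqr_sqrtr.
have /key : (0 < (Num.sqrt v + s) / 2)%R by rewrite divr_gt0 ?ltr_wpDl ?sqrtr_ge0.
have -> : ((Num.sqrt v + s) / 2 < s)%R by lra.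
move=> /(_ isT); apply/negP; rewrite -ltNge -[ltLHS]sqr_sqrtr//.
by rewrite ltr_pXn2r// ?nnegrE ?sqrtr_ge0 ?divr_ge0 ?addr_ge0 ?sqrtr_ge0 ?ltW//; lra.
Qed.

Lemma centered_gaussian_half (L : T -> R) :
    P.-integrable [set: T] (EFin \o L) -> \int[P]_w (L w)%:E = 0 ->
    gaussian_rv P L ->
  (2^-1)%:E <= P [set w | (0 <= L w)%R].
Proof.
move=> iL L0 gL; have mL : measurable_fun [set: T] L.
  by apply/measurable_EFinP; exact: measurable_int iL.
have -> : P [set w | (0 <= L w)%R] = pushforward P L `[0%R, +oo[%classic.
  by congr (P _); apply/seteqP; split => w /=; rewrite in_itv/= andbT.
have [law|[s s0 law]] := centered_gaussian_law iL L0 gL.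
  rewrite law//= diracE mem_set/= ?in_itv/= ?lexx// lee_fin; lra.
by rewrite law//= normal_prob_half.
Qed.

End gaussian.

(** * Increments of fractional Brownian motion *)

Section fbm.
Context d (T : measurableType d) (R : realType) (P : probability T R).
Variables (H : R) (B : R -> {RV P >-> R}).
Hypotheses (hH : 0 < H) (hB : fractional_brownian_motion H B).

Definition fbm_cov (t s : R) : R :=
  2^-1 * (t `^ (2 * H) + s `^ (2 * H) - `|t - s| `^ (2 * H)).

Lemma integral_fbmM t s : 0 <= t -> 0 <= s ->
  (\int[P]_w (B t w * B s w)%:E = (fbm_cov t s)%:E)%E.
Proof. by move=> t0 s0; case: hB => _ _ /(_ t s t0 s0); rewrite unlock. Qed.

Lemma integral_fbm t : 0 <= t -> (\int[P]_w (B t w)%:E = 0)%E.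
Proof. by move=> t0; case: hB => _ /(_ t t0); rewrite unlock. Qed.

Lemma integrable_fbm_sqr t : 0 <= t ->
  P.-integrable setT (fun w => (B t w ^+ 2)%:E).
Proof.
move=> t0; apply/integrableP; split.
  by apply/measurable_EFinP; exact: measurable_funX.
under eq_integral do rewrite gee0_abs ?lee_fin ?sqr_ge0// expr2.
by rewrite integral_fbmM// ltry.
Qed.

Lemma integrable_fbmM t s : 0 <= t -> 0 <= s ->
  P.-integrable setT (fun w => (B t w * B s w)%:E).
Proof.
move=> t0 s0.
apply: (le_integrable _ _ _ (integrableD _ (integrable_fbm_sqr t0) (integrable_fbm_sqr s0))) => //.
  by apply/measurable_EFinP; exact: measurable_funM.
move=> w _ /=; rewrite lee_fin normrM [leRHS]ger0_norm ?addr_ge0 ?sqr_ge0//.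
rewrite -(real_normK (num_real (B t w))) -(real_normK (num_real (B s w))).
have := sqr_ge0 (`|B t w| - `|B s w|).
have := sqr_ge0 `|B t w|; have := sqr_ge0 `|B s w|; nra.
Qed.

Lemma integrable_fbm t : 0 <= t -> P.-integrable setT (EFin \o B t).
Proof.
move=> t0; have i1 : P.-integrable setT (EFin \o cst (1 : R)).
  exact: finite_measure_integrable_cst.
apply: (le_integrable _ _ _ (integrableD _ i1 (integrable_fbm_sqr t0))) => //.
  exact/measurable_EFinP.
move=> w _ /=; rewrite lee_fin [leRHS]ger0_norm ?addr_ge0 ?sqr_ge0//.
rewrite -(real_normK (num_real (B t w))).
by have := sqr_ge0 (`|B t w| - 1); have := sqr_ge0 `|B t w|; nra.
Qed.

Section combination.
Variables (n : nat) (t c : 'I_n -> R).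
Hypothesis t0 : forall i, 0 <= t i.
Let L w := \sum_(i < n) c i * B (t i) w.

Lemma integrable_fbm_comb : P.-integrable setT (EFin \o L).
Proof.
apply: (eq_integrable _ (fun w => \sum_(i < n) (c i)%:E * (B (t i) w)%:E)%E) => //.
  by move=> w _ /=; rewrite -sumEFin; apply: eq_bigr => i _; rewrite EFinM.
by apply: integrable_sum => // i _; apply: integrableZl => //; exact: integrable_fbm.
Qed.

Lemma integral_fbm_comb : (\int[P]_w (L w)%:E = 0)%E.
Proof.
transitivity (\int[P]_w (\sum_(i < n) (c i)%:E * (B (t i) w)%:E))%E.
  by apply: eq_integral => w _ /=; rewrite -sumEFin; apply: eq_bigr => i _; rewrite EFinM.
rewrite integral_sum//; last first.
  by move=> i; apply: integrableZl => //; exact: integrable_fbm.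
rewrite big1// => i _.
by rewrite integralZl ?integral_fbm ?mule0//; exact: integrable_fbm.
Qed.

Lemma integral_fbm_comb_sqr : (\int[P]_w (L w ^+ 2)%:E =
  (\sum_(i < n) \sum_(j < n) c i * c j * fbm_cov (t i) (t j))%:E)%E.
Proof.
have iM i j : P.-integrable setT
    (fun w => (c i * c j)%:E * (B (t i) w * B (t j) w)%:E)%E.
  by apply: integrableZl => //; exact: integrable_fbmM.
transitivity (\int[P]_w (\sum_(i < n) \sum_(j < n)
    (c i * c j)%:E * (B (t i) w * B (t j) w)%:E))%E.
  apply: eq_integral => w _; rewrite expr2 /L big_distrlr/= -sumEFin.
  apply: eq_bigr => i _; rewrite -sumEFin; apply: eq_bigr => j _.
  by rewrite -EFinM; congr EFin; ring.
rewrite integral_sum//; last by move=> i; exact: integrable_sum.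
rewrite -sumEFin; apply: eq_bigr => i _; rewrite integral_sum//.
rewrite -sumEFin; apply: eq_bigr => j _.
by rewrite integralZl ?integral_fbmM//; exact: integrable_fbmM.
Qed.

Lemma gaussian_fbm_comb : gaussian_rv P L.
Proof. by case: hB => + _ _; exact. Qed.

End combination.

Section increments.
Variables (n : nat) (u v c : 'I_n -> R).
Hypotheses (u0 : forall i, 0 <= u i) (v0 : forall i, 0 <= v i).
Let L w := \sum_(i < n) c i * (B (u i) w - B (v i) w).

(** The covariance of [B a - B b] and [B a' - B b'] at nonnegative times: the single-time terms of
    [fbm_cov] cancel and only distances remain. *)
Definition fbm_incr_cov (a b a' b' : R) : R :=
  2^-1 * (`|a - b'| `^ (2 * H) + `|b - a'| `^ (2 * H)
          - `|a - a'| `^ (2 * H) - `|b - b'| `^ (2 * H)).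

Lemma fbm_incr_combination :
  [/\ P.-integrable setT (EFin \o L), (\int[P]_w (L w)%:E = 0)%E,
      gaussian_rv P L &
      (\int[P]_w (L w ^+ 2)%:E = (\sum_(i < n) \sum_(j < n)
         c i * c j * fbm_incr_cov (u i) (v i) (u j) (v j))%:E)%E].
Proof.
(* The [n] increments become a combination of [n + n] values: weights [c] at the times [u], then
   [- c] at the times [v]. *)
pose t (i : 'I_(n + n)) := match fintype.split i with inl j => u j | inr j => v j end.
pose e (i : 'I_(n + n)) := match fintype.split i with inl j => c j | inr j => - c j end.
have t0 i : 0 <= t i by rewrite /t; case: (fintype.split i).
have tl j : t (lshift n j) = u j by rewrite /t (unsplitK (inl j)).
have tr j : t (rshift n j) = v j by rewrite /t (unsplitK (inr j)).
have el j : e (lshift n j) = c j by rewrite /e (unsplitK (inl j)).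
have er j : e (rshift n j) = - c j by rewrite /e (unsplitK (inr j)).
have LE : L = fun w => \sum_(i < n + n) e i * B (t i) w.
  apply/funext => w; rewrite /L big_split_ord/= -big_split/=.
  by apply: eq_bigr => j _; rewrite tl tr el er; ring.
rewrite LE; split.
- exact: integrable_fbm_comb.
- exact: integral_fbm_comb.
- exact: gaussian_fbm_comb.
rewrite integral_fbm_comb_sqr//; congr EFin.
rewrite big_split_ord/= -big_split/=; apply: eq_bigr => i _.
rewrite !big_split_ord/= -!big_split/=; apply: eq_bigr => j _.
by rewrite !tl !tr !el !er /fbm_cov /fbm_incr_cov; ring.
Qed.

End increments.

Lemma fbm_incr_cov_diag a b : fbm_incr_cov a b a b = `|a - b| `^ (2 * H).
Proof.
rewrite /fbm_incr_cov !subrr normr0 powR0 ?mulf_neq0 ?gt_eqF// (distrC b a).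
by field.
Qed.

Lemma fbm_incr a b c : 0 <= a -> 0 <= b ->
  let L w := c * (B a w - B b w) in
  [/\ P.-integrable setT (EFin \o L), (\int[P]_w (L w)%:E = 0)%E,
      gaussian_rv P L &
      (\int[P]_w (L w ^+ 2)%:E = (c ^+ 2 * `|a - b| `^ (2 * H))%:E)%E].
Proof.
move=> a0 b0 L.
have -> : L = fun w => \sum_(i < 1) c * (B a w - B b w).
  by apply/funext => w; rewrite big_ord1.
have := @fbm_incr_combination 1 (fun=> a) (fun=> b) (fun=> c) (fun=> a0) (fun=> b0).
by rewrite !big_ord1 fbm_incr_cov_diag -expr2.
Qed.

End fbm.

(** * Nonnegative correlation of the increments over a uniform grid *)

Section power_second_difference.
Context {R : realType}.

(** The triangle inequality puts the absolute value of [x] below the mean of those of [x + h] and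
    [x - h]; the power is increasing and, as [1 <= q], convex. *)
Lemma powR_second_difference_ge0 (q x h : R) : 1 <= q ->
  `|x| `^ q *+ 2 <= `|x + h| `^ q + `|x - h| `^ q.
Proof.
move=> q1; have q0 : 0 <= q by lra.
have le_mid : `|x| <= (`|x + h| + `|x - h|) / 2.
  have := ler_normD (x + h) (x - h).
  rewrite (_ : x + h + (x - h) = x *+ 2); last by ring.
  by rewrite normrMn -mulr_natr; lra.
have mid : ((`|x + h| + `|x - h|) / 2) `^ q
    <= (`|x + h| `^ q + `|x - h| `^ q) / 2.
  have halfE (a b : R) : (a + b) / 2 = 2^-1 * a + (1 - 2^-1) * b by field.
  rewrite !halfE; apply: (convex_powR q1 (Itv01 _ _)) => //=;
    by rewrite ?inE/= ?in_itv/= ?normr_ge0// ?invr_ge0// invf_le1 ?ler1n.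
rewrite -mulr_natr -ler_pdivlMr//; apply: le_trans mid.
by rewrite ge0_ler_powR ?nnegrE ?divr_ge0 ?addr_ge0.
Qed.

End power_second_difference.

Section fbm_grid.
Context d (T : measurableType d) (R : realType) (P : probability T R).
Variables (H : R) (B : R -> {RV P >-> R}) (dt : R).
Hypotheses (hH : 2^-1 <= H) (hB : fractional_brownian_motion H B) (dt0 : 0 < dt).

Let t (n : nat) : R := n%:R * dt.

Lemma grid_ge0 n : 0 <= t n. Proof. by rewrite mulr_ge0// ltW. Qed.

Lemma gridS n : t n.+1 = t n + dt.
Proof. by rewrite /t -natr1 mulrDl mul1r. Qed.

(** The covariance is half a second difference, at [t j - t k] with step [dt], of the [2 * H]-th
    power of the absolute value; [2^-1 <= H] makes this power convex. *)
Lemma fbm_grid_cov_ge0 j k : 0 <= fbm_incr_cov H (t j.+1) (t j) (t k.+1) (t k).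
Proof.
have q1 : 1 <= 2 * H by move: hH; lra.
have := powR_second_difference_ge0 (t j - t k) dt q1.
rewrite /fbm_incr_cov !gridS.
have -> : t j + dt - t k = t j - t k + dt by ring.
have -> : t j - (t k + dt) = t j - t k - dt by ring.
have -> : t j + dt - (t k + dt) = t j - t k by ring.
rewrite -mulr_natr; lra.
Qed.

(** The increments add up to [B (t n) - B 0], whose variance this is; the proof telescopes over [k],
    then over [j]. *)
Lemma sum_fbm_grid_cov n :
  \sum_(j < n) \sum_(k < n) fbm_incr_cov H (t j.+1) (t j) (t k.+1) (t k) =
  t n `^ (2 * H).
Proof.
have H0 : 0 < H by move: hH; lra.
pose f j k : R := `|t j - t k| `^ (2 * H).
have fC j k : f j k = f k j by rewrite /f distrC.
have fd j : f j j = 0 by rewrite /f subrr normr0 powR0// mulf_neq0// gt_eqF.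
have tele (g : nat -> R) : \sum_(k < n) (g k.+1 - g k) = g n - g 0%N.
  by rewrite -(big_mkord xpredT (fun k => g k.+1 - g k)) telescope_sumr.
transitivity (\sum_(j < n) 2^-1 *
    ((f j.+1 0%N - f j.+1 n) - (f j 0%N - f j n))).
  apply: eq_bigr => j _.
  transitivity (\sum_(k < n) 2^-1 *
      ((f j k.+1 - f j.+1 k.+1) - (f j k - f j.+1 k))).
    by apply: eq_bigr => k _; rewrite /fbm_incr_cov /f (distrC (t j) (t k.+1)); ring.
  by rewrite -mulr_sumr (tele (fun k => f j k - f j.+1 k)); congr (_ * _); ring.
rewrite -mulr_sumr (tele (fun j => f j 0%N - f j n)) (fC 0%N n) !fd.
have -> : f n 0%N = t n `^ (2 * H).
  by rewrite /f /t mul0r subr0 ger0_norm// grid_ge0.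
by field.
Qed.

(** Since all covariances are nonnegative, replacing every weight by [s] bounds the variance of the
    sum by [s ^+ 2] times the total in [sum_fbm_grid_cov]. *)
Lemma fbm_grid_mgf_le n (c : 'I_n -> R) s : (forall k, `|c k| <= s) ->
  (\int[P]_w (expR (\sum_(k < n) c k * (B (t k.+1) w - B (t k) w)))%:E <=
   (expR (s ^+ 2 * t n `^ (2 * H) / 2))%:E)%E.
Proof.
move=> cs; have H0 : 0 < H by move: hH; lra.
have [iL L0 gL L2] := fbm_incr_combination hB c
  (fun i : 'I_n => grid_ge0 i.+1) (fun i : 'I_n => grid_ge0 i).
have := @centered_gaussian_mgf_le _ _ _ _ _ (s ^+ 2 * t n `^ (2 * H)) 1 iL L0 gL.
rewrite expr1n mul1r; under [in X in _ -> X]eq_integral do rewrite -[X in expR X]mul1r.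
apply; rewrite L2 lee_fin -sum_fbm_grid_cov mulr_sumr ler_sum// => j _.
rewrite mulr_sumr ler_sum// => k _; rewrite ler_wpM2r ?fbm_grid_cov_ge0//.
rewrite (le_trans (ler_norm _))// normrM expr2.
by rewrite ler_pM.
Qed.

End fbm_grid.

(** * Elementary bounds on the hyperbolic cosine, products and powers *)

Section real_inequalities.
Context {R : realType}.

(** [cosh x - 1] is half the square of [expR (x / 2) - expR (- (x / 2))], and for [0 <= x] that
    difference is at least [x / 2]. *)
Lemma cosh_ge (x : R) : 1 + x ^+ 2 / 8 <= (expR x + expR (- x)) / 2.
Proof.
wlog x0 : x / 0 <= x => [hwlog|].
  have [/hwlog//|/ltW x0] := leP 0 x.
  by have := hwlog (- x); rewrite oppr_ge0 opprK sqrrN [expR (- x) + _]addrC => /(_ x0).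
have e1 : 1 + x / 2 <= expR (x / 2) := expR_ge1Dx _.
have e2 : expR (- (x / 2)) <= 1 by rewrite expR_le1 oppr_le0 divr_ge0.
have e3 : 0 < expR (- (x / 2)) := expR_gt0 _.
have e4 : expR (x / 2) * expR (- (x / 2)) = 1 by rewrite expRxMexpNx_1.
have -> : expR x = expR (x / 2) ^+ 2 by rewrite -expRM_natl; congr expR; field.
have -> : expR (- x) = expR (- (x / 2)) ^+ 2.
  by rewrite -expRM_natl; congr expR; field.
have : (x / 2) ^+ 2 <= (expR (x / 2) - expR (- (x / 2))) ^+ 2.
  by rewrite ler_pXn2r// ?nnegrE ?divr_ge0//; lra.
rewrite sqrrB e4 => h; lra.
Qed.

(** The factors with [k.+1 <= x] multiply to a single term of the exponential series at [x], and the
    others equal 1. *)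
Lemma prod_max1_le_expR (x : R) n : 0 <= x ->
  \prod_(k < n) Num.max 1 (x / k.+1%:R) <= expR x.
Proof.
move=> x0; have pow_fact m : x ^+ m / m`!%:R <= expR x.
  case: m => [|m]; first by rewrite expr0 divr1 -[leLHS]expR0 ler_expR.
  by have := @expR_ge1Dxn _ x m x0; lra.
suff [//|->//] : \prod_(k < n) Num.max 1 (x / k.+1%:R) <= expR x \/
    \prod_(k < n) Num.max 1 (x / k.+1%:R) = x ^+ n / n`!%:R.
suff [[h1 h2]|[h1 h2]] : (\prod_(k < n) Num.max 1 (x / k.+1%:R) <= expR x /\ x <= n%:R) \/
    (\prod_(k < n) Num.max 1 (x / k.+1%:R) = x ^+ n / n`!%:R /\ n%:R <= x).
  - by left.
  - by right.
elim: n => [|n [[IH xn]|[IH xn]]].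
- by right; rewrite big_ord0 expr0 divr1.
- left; have xn1 : x <= n.+1%:R by rewrite (le_trans xn)// ler_nat.
  rewrite big_ord_recr/= max_l ?mulr1// ler_pdivrMr// mul1r//.
- rewrite big_ord_recr/=; have [xn1|xn1] := leP x n.+1%:R; [left|right].
    by rewrite max_l ?mulr1 ?ler_pdivrMr ?mul1r// IH; split=> //; exact: pow_fact.
  rewrite max_r ?ler_pdivlMr ?mul1r ?ltW// IH; split=> //.
  by rewrite exprSr factS natrM invfM; ring.
Qed.

Lemma powR_eventually_ge (e K dt : R) : 0 < e -> 0 < dt ->
  \forall n \near \oo, K <= (n%:R * dt) `^ e.
Proof.
move=> e0 dt0; pose K' := Num.max K 1.
have K0 : 0 <= K' by rewrite le_max ler01 orbT.
near=> n; apply: (@le_trans _ _ K'); first by rewrite le_max lexx.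
have -> : K' = (K' `^ e^-1) `^ e by rewrite -powRrM mulVf ?gt_eqF// powRr1.
apply: ge0_ler_powR; rewrite ?nnegrE ?powR_ge0//; first exact: ltW.
  by apply: mulr_ge0 => //; exact: ltW.
rewrite -ler_pdivrMr//; near: n; exact: nbhs_infty_ger.
Unshelve. all: by end_near. Qed.

End real_inequalities.

(** * The stochastic theta method *)

(** Young's inequality with weights [w] and [1 - w] separates [A] from the noise; [s] is chosen so
    that the noise term equals [M * (s * V) ^+ 2 / 8], which [cosh_ge] absorbs. *)
Lemma sqrrD_le_cosh {R : realType} (w M mu s A V : R) :
  0 < w -> w < 1 -> 0 < M -> s ^+ 2 = 8 * mu ^+ 2 / ((1 - w) * M) ->
  (A + mu * V) ^+ 2 <=
  Num.max (A ^+ 2 / w) M * ((expR (s * V) + expR (- (s * V))) / 2).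
Proof.
move=> w0 w1 M0 sE; have w1' : 0 < 1 - w by lra.
set m := Num.max _ _.
have mA : A ^+ 2 / w <= m by rewrite le_max lexx.
have mM : M <= m by rewrite le_max lexx orbT.
have : (A + mu * V) ^+ 2 <= A ^+ 2 / w + (mu * V) ^+ 2 / (1 - w).
  rewrite -subr_ge0.
  have -> : A ^+ 2 / w + (mu * V) ^+ 2 / (1 - w) - (A + mu * V) ^+ 2 =
      ((1 - w) * A - w * (mu * V)) ^+ 2 / (w * (1 - w)).
    by field; rewrite !gt_eqF.
  by rewrite divr_ge0 ?sqr_ge0// mulr_ge0// ltW.
have vE : (mu * V) ^+ 2 / (1 - w) = M * ((s * V) ^+ 2 / 8).
  by rewrite !exprMn sE; field; rewrite !gt_eqF.
move=> /le_trans; apply.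
apply: (@le_trans _ _ (m * (1 + (s * V) ^+ 2 / 8))).
  rewrite vE mulrDr mulr1 lerD// ler_wpM2r// divr_ge0 ?sqr_ge0//.
by rewrite ler_wpM2l ?cosh_ge// (le_trans _ mM)// ltW.
Qed.

Section theta_method.
Context d (T : measurableType d) (R : realType) (P : probability T R).
Variables (H : R) (B : R -> {RV P >-> R}) (dt : R).
Hypotheses (hH : 2^-1 <= H) (hB : fractional_brownian_motion H B) (dt0 : 0 < dt).

Let t (n : nat) : R := n%:R * dt.
Let V (n : nat) w : R := B (t n.+1) w - B (t n) w.

Lemma measurable_fbm_incr n : measurable_fun setT (V n).
Proof. exact: measurable_funB. Qed.

Lemma integral_prod_cosh n (s : R) :
  (\int[P]_w (\prod_(k < n) ((expR (s * V k w) + expR (- (s * V k w))) / 2))%:E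
   <= (expR (s ^+ 2 * t n `^ (2 * H) / 2))%:E)%E.
Proof.
wlog s0 : s / 0 <= s => [hwlog|].
  have [/hwlog//|/ltW s0] := leP 0 s.
  have := hwlog (- s); rewrite oppr_ge0 sqrrN => /(_ s0); apply: le_trans.
  rewrite le_eqVlt; apply/orP; left; apply/eqP/eq_integral => w _; congr EFin.
  by apply: eq_bigr => k _; rewrite mulNr opprK addrC.
pose c (f : {ffun 'I_n -> bool}) k := if f k then s else - s.
pose e f w := expR (\sum_(k < n) c f k * V k w).
have me f : measurable_fun setT (e f).
  apply: measurableT_comp => //; apply: measurable_sum => k.
  by apply: measurable_funM => //; exact: measurable_fbm_incr.
(* Expanding the product gives one exponential per choice of signs [f], each of weight [2^-1 ^+ n];
   [fbm_grid_mgf_le] bounds them uniformly. *)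
rewrite (eq_integral (fun w =>
    (\sum_(f : {ffun 'I_n -> bool}) (2^-1 ^+ n)%:E * (e f w)%:E)%E)); last first.
  move=> w _.
  rewrite -ge0_sume_distrr; last by move=> f _; rewrite lee_fin expR_ge0.
  rewrite sumEFin -EFinM; congr EFin.
  transitivity (\prod_(k < n) \sum_(b : bool)
     2^-1 * expR ((if b then s else - s) * V k w)).
    by apply: eq_bigr => k _; rewrite big_bool/= mulNr; field.
  rewrite bigA_distr_bigA/= mulr_sumr; apply: eq_bigr => f _.
  by rewrite big_split/= prodr_const card_ord /e expR_sum.
rewrite ge0_integral_sum//; last 2 first.
- by move=> f; apply: emeasurable_funM => //; exact/measurable_EFinP.
- by move=> f w _; rewrite mule_ge0 ?lee_fin ?expR_ge0 ?exprn_ge0 ?invr_ge0.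
apply: (@le_trans _ _ (\sum_(f : {ffun 'I_n -> bool}) (2^-1 ^+ n)%:E *
    (expR (s ^+ 2 * t n `^ (2 * H) / 2))%:E)%E).
  apply: lee_sum => f _; rewrite ge0_integralZl//; last 2 first.
  - exact/measurable_EFinP.
  - by move=> w _; rewrite lee_fin expR_ge0.
  rewrite lee_pmul2l ?lte_fin ?exprn_gt0 ?invr_gt0//.
  apply: fbm_grid_mgf_le => // k.
  by rewrite /c; case: ifP; rewrite ?normrN ger0_norm.
under eq_bigr do rewrite -EFinM.
rewrite sumEFin lee_fin -mulr_suml sumr_const card_ffun card_bool card_ord.
by rewrite -[_ *+ (2 ^ n)]mulr_natl natrX -exprMn divff// expr1n mul1r.
Qed.

Variables (X0 kappa lambda mu theta : R).
Hypotheses (kl0 : 0 < kappa * lambda) (theta0 : 0 < theta).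

Let A (n : nat) : R := 1 - kappa * lambda * (1 - theta) * t n `^ (kappa - 1) * dt.
Let D (n : nat) : R := 1 + kappa * lambda * theta * t n.+1 `^ (kappa - 1) * dt.

Lemma theta_denom_ge1 n : 1 <= D n.
Proof.
rewrite lerDl; apply: mulr_ge0 (ltW dt0); apply: mulr_ge0 (powR_ge0 _ _).
by apply: mulr_ge0; exact: ltW.
Qed.

Lemma theta_denom_gt0 n : 0 < D n.
Proof. exact: lt_le_trans (theta_denom_ge1 n). Qed.

Lemma theta_method_prod (X : nat -> {RV P >-> R}) :
  theta_method B X0 kappa lambda mu theta dt X ->
  forall n w, X n w = X0 * \prod_(k < n) ((A k + mu * V k w) / D k).
Proof.
move=> [X0E XS] n w; elim: n => [|n IH]; first by rewrite big_ord0 mulr1.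
rewrite big_ord_recr/= mulrA -IH.
have D0 := theta_denom_gt0 n.
have : X n.+1 w * D n = X n w * (A n + mu * V n w).
  by rewrite /D mulrDr mulr1 {1}XS /A /V /t; ring.
by move=> XD; rewrite mulrA -XD mulfK// gt_eqF.
Qed.

(** [mean_square_stable] quantifies over all solutions of the scheme, so refuting it requires an
    actual one. *)
Lemma theta_method_exists :
  exists X : nat -> {RV P >-> R}, theta_method B X0 kappa lambda mu theta dt X.
Proof.
pose Vm k : {mfun T >-> R} := (B (t k.+1) : {mfun T >-> R}) - (B (t k) : {mfun T >-> R}).
pose cm (a : R) : {mfun T >-> R} := cst a.
pose F k : {mfun T >-> R} := cm (A k / D k) + cm (mu / D k) * Vm k.
pose X n : {mfun T >-> R} := cm X0 * \prod_(k < n) F k.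
exists X; split=> [w|n w].
  by rewrite /X big_ord0 mulr1.
have prodE m : (\prod_(k < m) F k) w = \prod_(k < m) F k w.
  elim: m => [|m IH]; first by rewrite !big_ord0.
  by rewrite !big_ord_recr -IH.
have XE m : X m w = X0 * \prod_(k < m) ((A k + mu * V k w) / D k).
  transitivity (X0 * (\prod_(k < m) F k) w); first by [].
  rewrite prodE; congr (_ * _); apply: eq_bigr => k _.
  have -> : F k w = A k / D k + mu / D k * V k w by [].
  by ring.
have D0 := theta_denom_gt0 n.
have XD : X n.+1 w * D n = X n w * (A n + mu * V n w).
  by rewrite !XE big_ord_recr/=; field; rewrite gt_eqF.
have : X n.+1 w = X n w * (A n + mu * V n w) - X n.+1 w * (D n - 1).
  by rewrite -XD; ring.
by move=> {1}->; rewrite /A /D /V /t; ring.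
Qed.

(** [M] is common to all factors, so that [integral_prod_cosh] applies with a single [s], but it may
    depend on [n]. *)
Lemma theta_method_moment_le (X : nat -> {RV P >-> R}) n (w M : R) :
  theta_method B X0 kappa lambda mu theta dt X ->
  0 < w -> w < 1 -> 0 < M ->
  ('E_P[fun om => (`|X n om| ^+ 2)%R] <=
   (X0 ^+ 2 * (\prod_(k < n) (Num.max (A k ^+ 2 / w) M / D k ^+ 2)) *
    expR (4 * mu ^+ 2 / ((1 - w) * M) * t n `^ (2 * H)))%:E)%E.
Proof.
move=> hX w0 w1 M0; pose s := Num.sqrt (8 * mu ^+ 2 / ((1 - w) * M)).
have w1' : 0 < 1 - w by lra.
have sE : s ^+ 2 = 8 * mu ^+ 2 / ((1 - w) * M).
  rewrite sqr_sqrtr//; apply: divr_ge0; apply: mulr_ge0 => //; first exact: sqr_ge0.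
  - exact: ltW.
  - exact: ltW.
set C := X0 ^+ 2 * _.
have max_ge0 k : 0 <= Num.max (A k ^+ 2 / w) M by rewrite le_max (ltW M0) orbT.
have C0 : 0 <= C.
  rewrite mulr_ge0 ?sqr_ge0// prodr_ge0// => k _.
  by rewrite divr_ge0 ?sqr_ge0.
pose ch n om := \prod_(k < n) ((expR (s * V k om) + expR (- (s * V k om))) / 2).
have ch0 om : 0 <= ch n om.
  by rewrite prodr_ge0// => k _; rewrite divr_ge0 ?addr_ge0 ?expR_ge0.
have mch : measurable_fun setT (ch n).
  apply: measurable_prod => k _; apply: measurable_funM => //.
  apply: measurable_funD; apply: measurableT_comp => //.
    by apply: measurable_funM => //; exact: measurable_fbm_incr.
  apply: measurableT_comp => //.
  by apply: measurable_funM => //; exact: measurable_fbm_incr.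
rewrite unlock.
apply: (@le_trans _ _ (\int[P]_om (C%:E * (ch n om)%:E))%E).
  apply: ge0_le_integral => //.
  - by apply/measurable_EFinP; apply: measurable_funX; exact: measurableT_comp.
  - by apply: emeasurable_funM => //; exact/measurable_EFinP.
  move=> om _; rewrite -EFinM lee_fin real_normK ?num_real//.
  rewrite (theta_method_prod hX) exprMn /C -[leRHS]mulrA ler_wpM2l ?sqr_ge0//.
  rewrite -prodrXl /ch -big_split/= ler_prod// => k _.
  rewrite sqr_ge0/= expr_div_n [leRHS]mulrAC ler_wpM2r ?invr_ge0 ?sqr_ge0//.
  exact: sqrrD_le_cosh.
rewrite ge0_integralZl//; last 2 first.
- exact/measurable_EFinP.
- by move=> om _; rewrite lee_fin.
rewrite [leRHS]EFinM lee_wpmul2l ?lee_fin//.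
apply: le_trans (integral_prod_cosh n s) _.
rewrite lee_fin ler_expR sE le_eqVlt; apply/orP; left; apply/eqP.
by field; rewrite !gt_eqF.
Qed.

End theta_method.

(** * Stability *)

Lemma prod_powR {R : realType} n (f : nat -> R) (p : R) :
  (forall k, 0 <= f k) ->
  \prod_(k < n) f k `^ p = (\prod_(k < n) f k) `^ p.
Proof.
move=> f0; elim: n => [|n IH]; first by rewrite !big_ord0 powR1.
by rewrite !big_ord_recr/= IH powRM// prodr_ge0.
Qed.

(** If the maximum is [M], the denominator exceeds [al * theta * a'] and the power of [y] is what
    remains. Otherwise, either the deterministic part lies in [[-1, 1]] and its term is at most [M],
    or its absolute value is at most [r], hence [w], times the denominator. *)
Lemma theta_factor_le {R : realType} (w r al theta a a' y p M : R) :
  0 < w -> 0 <= r -> r <= w -> 0 < al -> 0 < theta ->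
  1 - theta = r * theta -> 0 <= a -> a <= a' -> 0 < a' -> 0 <= p -> 0 <= y ->
  w^-1 <= M -> M = w * (theta * al * a') ^+ 2 * y `^ p ->
  Num.max ((1 - al * (1 - theta) * a) ^+ 2 / w) M
    / (1 + al * theta * a') ^+ 2
  <= w * Num.max 1 y `^ p.
Proof.
move=> w0 r0 rw al0 th0 rE a0 aa' a'0 p0 y0 wM ME.
set A := 1 - _; set D := 1 + _.
have e0 : 0 < al * theta * a' by rewrite !mulr_gt0.
have D1 : 1 <= D by rewrite lerDl ltW.
have D0 : 0 < D by apply: lt_le_trans D1.
have m1 : 1 <= Num.max 1 y by rewrite le_max lexx.
have mp1 : 1 <= Num.max 1 y `^ p by rewrite -[leLHS](powRr0 (Num.max 1 y)) ler_powR.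
have wle : w <= w * Num.max 1 y `^ p by rewrite ler_peMr// ltW.
have MD : M / D ^+ 2 <= w * Num.max 1 y `^ p.
  rewrite ler_pdivrMr ?exprn_gt0// ME.
  rewrite [leRHS]mulrAC ler_pM ?powR_ge0//.
  - by rewrite mulr_ge0 ?sqr_ge0// ltW.
  - apply: ler_wpM2l; first exact: ltW.
    rewrite (mulrC theta) lerXn2r ?nnegrE ?(ltW D0) ?(ltW e0)//.
    by rewrite /D; lra.
  - by rewrite ge0_ler_powR ?nnegrE ?(le_trans ler01 m1)// le_max lexx orbT.
rewrite ler_pdivrMr ?exprn_gt0// ge_max -[X in _ && X]ler_pdivrMr ?exprn_gt0// MD andbT.
have [A1|A1] := leP (-1) A.
  have A2 : A ^+ 2 / w <= M.
    apply: le_trans wM; apply: ler_piMl; first by rewrite invr_ge0 ltW.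
    have : A <= 1.
      rewrite /A rE gerBl; apply: mulr_ge0 => //; apply: mulr_ge0; first exact: ltW.
      by apply: mulr_ge0 => //; exact: ltW.
    by nra.
  by apply: le_trans A2 _; rewrite -ler_pdivrMr// exprn_gt0.
apply: (@le_trans _ _ (w * D ^+ 2)); last by rewrite ler_wpM2r// sqr_ge0.
rewrite ler_pdivrMr// mulrAC -expr2 -exprMn -sqrrN ler_pXn2r// ?nnegrE.
- rewrite (@le_trans _ _ (r * D))// ?ler_wpM2r ?(ltW D0)//.
  have : r * (al * theta * a) <= r * (al * theta * a').
    by rewrite !ler_wpM2l// mulr_ge0// ltW.
  have -> : r * (al * theta * a) = al * (1 - theta) * a by rewrite rE; ring.
  by rewrite /A /D; lra.
- lra.
- by rewrite mulr_ge0// ltW.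
Qed.

Section stability.
Context d (T : measurableType d) (R : realType) (P : probability T R).
Variables (H : R) (B : R -> {RV P >-> R}).
Hypotheses (hH : 2^-1 < H) (hB : fractional_brownian_motion H B).
Variables (X0 kappa lambda mu theta : R).
Hypotheses (hkappa : 2 * H <= kappa) (lambda0 : 0 < lambda).

Lemma theta_method_stable :
  2^-1 < theta -> theta <= 1 ->
  unconditionally_mean_square_stable B X0 kappa lambda mu theta.
Proof.
move=> th th1 dt dt0 X hX.
have th0 : 0 < theta by lra.
have kappa0 : 0 < kappa by move: hH hkappa; lra.
pose t n : R := n%:R * dt.
pose p := kappa - 1; have p0 : 0 < p by rewrite /p; move: hH hkappa; lra.
pose al := kappa * lambda * dt; have al0 : 0 < al by rewrite !mulr_gt0.
(* [theta > 1/2] amounts to [r < 1], which leaves room for [w] halfway between [r] and 1. *)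
pose r := (1 - theta) / theta; pose w := (1 + r) / 2.
have rE : 1 - theta = r * theta by rewrite /r divfK// gt_eqF.
have r0 : 0 <= r by rewrite divr_ge0 ?subr_ge0// ltW.
have r1 : r < 1 by rewrite ltr_pdivrMr// mul1r; lra.
have w0 : 0 < w by rewrite /w; lra.
have w1 : w < 1 by rewrite /w; lra.
have rw : r <= w by rewrite /w; lra.
(* The maxima and the noise will cost at most [expR (eps * n)] to the power [2 * p + 1]; this [eps]
   makes the cost cancel exactly half of the decay of [w ^+ n]. *)
pose eps := - ln w / (2 * (2 * p + 1)).
have eps0 : 0 < eps.
  by rewrite divr_gt0 ?oppr_gt0 ?ln_lt0 ?w0//; lra.
(* [c] gives [M n] the form required by [theta_factor_le], with [y = eps * n / k.+1], for every
   [k < n]. *)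
pose c := w * (theta * al) ^+ 2 * eps `^ (2 * p).
have c0 : 0 < c.
  rewrite mulr_gt0 ?powR_gt0//; apply: mulr_gt0 => //.
  by apply: exprn_gt0; exact: mulr_gt0.
pose M n := c * t n `^ (2 * p).
pose K := 4 * mu ^+ 2 / ((1 - w) * c).
have bound : \forall n \near \oo,
    ('E_P[fun om => (`|X n om| ^+ 2)%R] <= (X0 ^+ 2 * expR (ln w / 2) ^+ n)%:E)%E.
  near=> n.
  have n0 : (0 < n)%N by near: n; exact: nbhs_infty_gt.
  have tn0 : 0 < t n by rewrite mulr_gt0// ltr0n.
  have wM : w^-1 <= M n.
    rewrite /M mulrC -ler_pdivrMr//; near: n; apply: powR_eventually_ge => //.
    by rewrite mulr_gt0.
  have M0 : 0 < M n by apply: lt_le_trans wM; rewrite invr_gt0.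
  (* The noise exponent grows more slowly than [n], since [1 < 2 * H <= kappa] gives
     [2 * H < 2 * p + 1]. *)
  have expn : 4 * mu ^+ 2 / ((1 - w) * M n) * t n `^ (2 * H) <= eps * n%:R.
    have -> : 4 * mu ^+ 2 / ((1 - w) * M n) * t n `^ (2 * H) =
        K * dt * (n%:R / t n `^ (2 * p + 1 - 2 * H)).
      rewrite powRB ?(gt_eqF tn0) ?implybT// powRD ?(gt_eqF tn0) ?implybT//.
      rewrite powRr1 ?(ltW tn0)// /K /M [in RHS]/t; field.
      by rewrite !gt_eqF ?powR_gt0 ?ltr0n// subr_gt0.
    rewrite mulrA ler_pdivrMr ?powR_gt0// [leRHS]mulrAC; apply: ler_wpM2r => //.
    rewrite -ler_pdivrMl//; near: n; apply: powR_eventually_ge => //.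
    by rewrite /p; move: hH hkappa; lra.
  have kl0 : 0 < kappa * lambda by rewrite mulr_gt0.
  apply: le_trans (theta_method_moment_le (ltW hH) hB dt0 kl0 th0 n hX w0 w1 M0) _.
  rewrite lee_fin/= -mulrA ler_wpM2l ?sqr_ge0//.
  apply: (@le_trans _ _ ((w ^+ n * expR (eps * n%:R) `^ (2 * p)) * expR (eps * n%:R))).
    apply: ler_pM; [|exact: expR_ge0| |by rewrite ler_expR].
      apply: prodr_ge0 => k _; apply: divr_ge0; rewrite ?sqr_ge0//.
      by rewrite le_max (ltW M0) orbT.
    apply: (@le_trans _ _ (\prod_(k < n)
        (w * Num.max 1 (eps * n%:R / k.+1%:R) `^ (2 * p)))).
      apply: ler_prod => k _; apply/andP; split.
        by apply: divr_ge0; rewrite ?sqr_ge0// le_max (ltW M0) orbT.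
      have tk : t k <= t k.+1 by rewrite ler_wpM2r ?ler_nat// ltW.
      have -> : kappa * lambda * (1 - theta) * (k%:R * dt) `^ (kappa - 1) * dt =
          al * (1 - theta) * t k `^ p by rewrite /al /t /p; ring.
      have -> : kappa * lambda * theta * (k.+1%:R * dt) `^ (kappa - 1) * dt =
          al * theta * t k.+1 `^ p by rewrite /al /t /p; ring.
      apply: (@theta_factor_le _ w r) => //.
      - exact: powR_ge0.
      - apply: ge0_ler_powR => //; rewrite ?nnegrE ?grid_ge0//; exact: ltW.
      - by rewrite powR_gt0// mulr_gt0.
      - by rewrite mulr_ge0// ltW.
      - by rewrite divr_ge0// mulr_ge0// ltW.
      rewrite /M /c exprMn.
      have -> : eps * n%:R / k.+1%:R = eps * t n / t k.+1.
        by rewrite /t; field; rewrite gt_eqF//= pnatr_eq0.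
      have gk m : 0 <= t m := grid_ge0 dt0 m.
      have gi m : 0 <= (t m)^-1 by rewrite invr_ge0 gk.
      rewrite (powRM _ (mulr_ge0 (ltW eps0) (gk n)) (gi k.+1)).
      rewrite (powRM _ (ltW eps0) (gk n)).
      rewrite -(powR_inv1 (gk _)) -powRrM mulN1r powRN.
      have -> : t k.+1 `^ (2 * p) = (t k.+1 `^ p) ^+ 2.
        by rewrite mulrC powRrM powR_mulrn// powR_ge0.
      by field; rewrite gt_eqF// powR_gt0// mulr_gt0.
    rewrite big_split/= prodr_const card_ord.
    rewrite (@prod_powR _ _ (fun k => Num.max 1 (eps * n%:R / k.+1%:R))); last first.
      by move=> k; rewrite le_max ler01.
    rewrite ler_wpM2l ?exprn_ge0 ?(ltW w0)//.
    apply: ge0_ler_powR; rewrite ?nnegrE ?expR_ge0 ?mulr_ge0 ?(ltW p0)//.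
      by apply: prodr_ge0 => k _; rewrite le_max ler01.
    by apply: prod_max1_le_expR; rewrite mulr_ge0// ltW.
  rewrite -expRM -mulrA -expRD -{1}(lnK w0) -!expRM_natl -expRD ler_expR.
  rewrite le_eqVlt; apply/orP; left; apply/eqP; rewrite /eps; field.
  by rewrite gt_eqF//; lra.
have lim0 : ((X0 ^+ 2 * expR (ln w / 2) ^+ n)%:E @[n --> \oo] --> 0%:E)%E.
  apply: cvg_EFin; first exact: nearW.
  rewrite -[X in _ --> X](mulr0 (X0 ^+ 2)); apply: cvgMr; apply: cvg_expr.
  rewrite ger0_norm ?expR_ge0// expR_lt1.
  by rewrite pmulr_llt0 ?invr_gt0// ln_lt0// w0.
apply: (squeeze_cvge _ (cvg_cst 0%E) lim0).
near=> n; apply/andP; split; last by near: n.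
by apply: expectation_ge0 => om; rewrite sqr_ge0.
Unshelve. all: by end_near. Qed.

End stability.

(** * Instability *)

(** Each new term is at most the difference of two consecutive inverses. The inverse of 0 is 0, so
    [n = 0] is apart and the induction starts at 1. *)
Lemma sum_inv_sqr_le {R : realType} n :
  \sum_(k < n) (k.+1%:R ^- 2 : R) <= 2 - n%:R^-1.
Proof.
case: n => [|n]; first by rewrite big_ord0 invr0 subr0.
elim: n => [|n IH]; first by rewrite big_ord1 expr1n invr1; lra.
rewrite big_ord_recr/=; apply: le_trans (lerD IH (lexx _)) _.
have a0 : 0 < n.+1%:R :> R by rewrite ltr0n.
rewrite -[n.+2%:R]natr1; move: (n.+1%:R : R) a0 => a a0.
have a10 : 0 < a + 1 by rewrite addr_gt0.
have : 0 <= (a * (a + 1) ^+ 2)^-1 by rewrite invr_ge0 mulr_ge0 ?sqr_ge0 ?ltW.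
have -> : (a * (a + 1) ^+ 2)^-1 = a^-1 - (a + 1)^-1 - (a + 1) ^- 2.
  by field; rewrite !gt_eqF.
lra.
Qed.

(** Apply [ln y < y] at [y = m.+1 / a], where [a = p / ln g] makes [p * y] equal to [m.+1 * ln g];
    the witness collects the terms free of [m]. *)
Lemma powR_le_geometric {R : realType} (g p : R) : 1 < g -> 0 < p ->
  exists2 c : R, 0 < c & forall m, c * m.+1%:R `^ p <= g ^+ m.
Proof.
move=> g1 p0; have g0 : 0 < g by lra.
have lg0 : 0 < ln g by rewrite ln_gt0.
pose a := p / ln g; have a0 : 0 < a by rewrite divr_gt0.
exists (expR (- (ln g + p * ln a))); first exact: expR_gt0.
move=> m; have m0 : 0 < m.+1%:R :> R by rewrite ltr0n.
rewrite -[X in X ^+ m](lnK g0) -[X in X `^ p](lnK m0) -expRM -expRD -expRM_natl.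
rewrite ler_expR.
have /ltW : ln (m.+1%:R / a) < m.+1%:R / a by rewrite ln_sublinear// divr_gt0.
rewrite ln_div ?posrE// => /(ler_wpM2l (ltW p0)).
have -> : p * (m.+1%:R / a) = m.+1%:R * ln g.
  by rewrite /a; field; rewrite !gt_eqF.
by rewrite -natr1; lra.
Qed.

(* [k `^ e >= 1 + e ln k] turns the stretched exponential tail into a
   summable power. *)
Lemma expR_powR_le_inv_sqr {R : realType} (Y e : R) k : 0 <= Y -> 0 <= e -> 2 <= Y * e ->
  expR (- (Y * k.+1%:R `^ e)) <= expR (- Y) * k.+1%:R ^- 2.
Proof.
move=> Y0 e0 Ye; have k0 : 0 < k.+1%:R :> R by rewrite ltr0n.
have k1 : 1 <= k.+1%:R :> R by rewrite ler1n.
rewrite -[X in X ^- 2](lnK k0) -expRM_natl -expRN -expRD ler_expR.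
have : 1 + e * ln k.+1%:R <= k.+1%:R `^ e.
  by rewrite -[X in X `^ e](lnK k0) -expRM mulrC expR_ge1Dx.
move/(ler_wpM2l Y0); have := ler_wpM2r (ln_ge0 k1) Ye; lra.
Qed.

(** The perturbation [v] leaves the numerator at least [(1 - eta) * (1 - theta) * (al * a) - 1] in
    absolute value, while [a / a' <= 1] keeps [g * (a / a')] times the denominator at most
    [g + g * theta * (al * a)]. *)
Lemma theta_ratio_ge {R : realType} (theta eta g al a a' v : R) :
  0 < theta -> 0 < a -> a <= a' -> 0 < al -> 1 < g ->
  1 + g <= ((1 - eta) * (1 - theta) - g * theta) * (al * a) ->
  `|v| <= eta * (1 - theta) * al * a ->
  g * (a / a') <= `|(1 - al * (1 - theta) * a + v) / (1 + al * theta * a')|.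
Proof.
move=> th0 a0 aa' al0 g1 big hv.
have a'0 : 0 < a' by apply: lt_le_trans aa'.
have D0 : 0 < 1 + al * theta * a' by rewrite addr_gt0 ?mulr_gt0.
rewrite normrM normfV (gtr0_norm D0) ler_pdivlMr//.
have aa1 : a / a' <= 1 by rewrite ler_pdivrMr// mul1r.
have -> : g * (a / a') * (1 + al * theta * a') = g * (a / a') + g * theta * (al * a).
  by field; rewrite gt_eqF.
have : g * (a / a') <= g by rewrite ler_piMr//; lra.
have := ler_norm (- (1 - al * (1 - theta) * a + v)); rewrite normrN.
have := ler_norm v; lra.
Qed.

Section gaussian_tail.
Context d (T : measurableType d) (R : realType) (P : probability T R).

(* The integrand dominates the indicator of [x <= `|L|]. *)
Lemma centered_gaussian_tail (L : T -> R) (v x : R) :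
    P.-integrable setT (EFin \o L) -> (\int[P]_w (L w)%:E = 0)%E ->
    gaussian_rv P L -> (\int[P]_w (L w ^+ 2)%:E <= v%:E)%E -> 0 < v ->
  (\int[P]_w (expR (- (x ^+ 2 / v)) *
     (expR (x / v * L w) + expR (- (x / v) * L w)))%:E <=
   (2 * expR (- (x ^+ 2 / (2 * v))))%:E)%E.
Proof.
move=> iL L0 gL L2 v0; have mL : measurable_fun [set: T] L.
  by apply/measurable_EFinP; exact: measurable_int iL.
have me a : measurable_fun setT (fun w => (expR (a * L w))%:E).
  by apply/measurable_EFinP; apply: measurableT_comp => //; exact: measurable_funM.
under eq_integral do rewrite EFinM EFinD.
rewrite ge0_integralZl//; last 2 first.
- exact: emeasurable_funD.
- by move=> w _; rewrite adde_ge0 ?lee_fin ?expR_ge0.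
rewrite ge0_integralD//.
have h1 := centered_gaussian_mgf_le (x / v) iL L0 gL L2.
have h2 := centered_gaussian_mgf_le (- (x / v)) iL L0 gL L2.
apply: le_trans (lee_wpmul2l _ (leeD h1 h2)) _; first by rewrite lee_fin expR_ge0.
have double (y z : R) : z * (y + y) = 2 * (z * y) by ring.
rewrite sqrrN -EFinD -EFinM lee_fin double -expRD.
rewrite le_eqVlt; apply/orP; left; apply/eqP; congr (_ * expR _).
by field; rewrite gt_eqF.
Qed.

End gaussian_tail.

Section instability.
Context d (T : measurableType d) (R : realType) (P : probability T R).
Variables (H : R) (B : R -> {RV P >-> R}).
Hypotheses (hH : 2^-1 < H) (hB : fractional_brownian_motion H B).
Variables (X0 kappa lambda mu theta : R).
Hypotheses (hX0 : X0 != 0) (hkappa : 2 * H <= kappa) (lambda0 : 0 < lambda).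

Lemma theta_method_unstable : 0 < theta -> theta < 2^-1 ->
  ~ unconditionally_mean_square_stable B X0 kappa lambda mu theta.
Proof.
move=> th0 th1 stable.
have H0 : 0 < H by move: hH; lra.
have kappa0 : 0 < kappa by move: hH hkappa; lra.
pose p := kappa - 1; have p0 : 0 < p by rewrite /p; move: hH hkappa; lra.
pose beta := 1 - 2 * theta; have beta0 : 0 < beta by rewrite /beta; lra.
(* With these values [(1 - eta) * (1 - theta) - g * theta] is [3 / 4 * beta]: the gap pays for both
   the growth rate [g] and the noise margin [eta]. *)
pose eta := beta / 4; pose g := 1 + beta / 4.
have eta0 : 0 < eta by rewrite /eta; lra.
have g1 : 1 < g by rewrite /g; lra.
have gap : beta / 2 <= (1 - eta) * (1 - theta) - g * theta.
  by rewrite /eta /g /beta; nra.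
(* The constant of the Gaussian exponent in [YE]; [mu ^+ 2 + 1] instead of [mu ^+ 2] keeps the
   denominator positive when [mu = 0]. *)
pose c2 := (eta * (1 - theta) * kappa * lambda) ^+ 2 / (2 * (mu ^+ 2 + 1)).
have mu1 : 0 < mu ^+ 2 + 1 by rewrite ltr_wpDl ?sqr_ge0.
have c20 : 0 < c2.
  apply: divr_gt0; last by rewrite mulr_gt0.
  by apply: exprn_gt0; rewrite !mulr_gt0//; lra.
have kl0 : 0 < kappa * lambda by rewrite mulr_gt0.
(* A large step size: the first bound yields [big], the hypothesis of [theta_ratio_ge] from index 1
   on; the second makes the Gaussian tails small. *)
have [dt [dt0 dtA dtY]] : exists dt : R, [/\ 0 < dt,
    (1 + g) / (beta / 2 * (kappa * lambda)) <= dt `^ kappa &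
    (16 + p^-1) / c2 <= dt `^ (2 * kappa - 2 * H)].
  suff /filter_ex[n [n0 h1 h2]] : \forall n \near \oo, [/\ (0 < n)%N,
      (1 + g) / (beta / 2 * (kappa * lambda)) <= (n%:R * 1) `^ kappa &
      (16 + p^-1) / c2 <= (n%:R * 1) `^ (2 * kappa - 2 * H)].
    by exists n%:R; rewrite ltr0n -[n%:R]mulr1; split.
  near=> n; split; near: n; first exact: nbhs_infty_gt.
    exact: powR_eventually_ge.
  by apply: powR_eventually_ge => //; move: hH hkappa; lra.
have [X hX] := theta_method_exists B dt0 X0 mu kl0 th0.
pose t n : R := n%:R * dt.
have t0 n : 0 <= t n := grid_ge0 dt0 n.
pose V n w := B (t n.+1) w - B (t n) w.
pose al := kappa * lambda * dt; have al0 : 0 < al by rewrite mulr_gt0.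
pose a n := t n `^ p.
have a0 n : 0 < a n.+1 by rewrite powR_gt0// mulr_gt0.
have aS n : a n <= a n.+1.
  apply: ge0_ler_powR; rewrite ?nnegrE// ?(ltW p0)//.
  by rewrite ler_wpM2r ?ler_nat// ltW.
have aE n : a n = n%:R `^ p * dt `^ p by rewrite /a powRM// ltW.
have dtp : dt * dt `^ p = dt `^ kappa by rewrite mulr_powRB1// ltW.
have big n : 1 + g <= ((1 - eta) * (1 - theta) - g * theta) * (al * a n.+1).
  apply: (@le_trans _ _ (beta / 2 * (al * a n.+1))); last first.
    by rewrite ler_wpM2r// mulr_ge0// ltW.
  move: dtA; rewrite ler_pdivrMr; last by rewrite !mulr_gt0.
  move=> /le_trans; apply.
  have -> : beta / 2 * (al * a n.+1) =
      dt `^ kappa * n.+1%:R `^ p * (beta / 2 * (kappa * lambda)).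
    by rewrite aE -dtp /al; ring.
  rewrite ler_wpM2r ?mulr_ge0 ?divr_ge0 ?(ltW beta0) ?(ltW kappa0) ?(ltW lambda0)//.
  rewrite ler_peMr ?powR_ge0// -[leLHS](powRr0 n.+1%:R) ler_powR ?ler1n//.
  exact: ltW.
pose v := (mu ^+ 2 + 1) * dt `^ (2 * H).
have v0 : 0 < v by rewrite mulr_gt0// powR_gt0.
(* The noise that [theta_ratio_ge] tolerates at index [k.+1]; index 0 is treated apart because [a 0]
   vanishes. *)
pose x k := eta * (1 - theta) * al * a k.+1.
have x0 k : 0 < x k by rewrite !mulr_gt0//; lra.
pose Y := c2 * dt `^ (2 * kappa - 2 * H).
(* The 16 brings the total tail [4 * expR (- Y)] below [1 / 4] through [1 + Y <= expR Y]; the [p^-1]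
   ensures [2 <= Y * (2 * p)]. *)
have Y16 : 16 + p^-1 <= Y by move: dtY; rewrite ler_pdivrMr// mulrC.
have pV0 : 0 < p^-1 by rewrite invr_gt0.
have YE k : x k ^+ 2 / (2 * v) = Y * k.+1%:R `^ (2 * p).
  rewrite /x /Y /v aE (@powRB _ dt (2 * kappa)); last by rewrite (gt_eqF dt0) implybT.
  have -> : k.+1%:R `^ (2 * p) = (k.+1%:R `^ p) ^+ 2 :> R.
    by rewrite mulrC powRrM powR_mulrn// powR_ge0.
  have -> : dt `^ (2 * kappa) = (dt `^ kappa) ^+ 2.
    by rewrite mulrC powRrM powR_mulrn// powR_ge0.
  rewrite -dtp /al /c2; field.
  by rewrite !gt_eqF ?powR_gt0.
have [c3 c30 hc3] := powR_le_geometric g1 p0.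
pose D0 := 1 + al * theta * a 1%N.
have D00 : 0 < D0 by rewrite addr_gt0// !mulr_gt0.
(* A lower bound for [X m.+1 ^+ 2] when [L 0 >= 0] and no later noise passes its threshold: [D0]
   comes from step 0, [c3] from the other steps. *)
pose c := (`|X0| / D0 * c3) ^+ 2.
have c0 : 0 < c by rewrite exprn_gt0// mulr_gt0// divr_gt0// normr_gt0.
pose L k w := mu * V k w.
have Lfact k : [/\ P.-integrable setT (EFin \o L k), (\int[P]_w (L k w)%:E = 0)%E,
      gaussian_rv P (L k) & (\int[P]_w (L k w ^+ 2)%:E <= v%:E)%E].
  have [iL L0 gL L2] := fbm_incr H0 hB mu (t0 k.+1) (t0 k).
  split => //; rewrite L2 lee_fin /t.
  have -> : k.+1%:R * dt - k%:R * dt = dt by rewrite -natr1; ring.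
  by rewrite (gtr0_norm dt0) /v ler_wpM2r ?powR_ge0// lerDl.
have XE n w : X n w = X0 * \prod_(k < n)
    ((1 - al * (1 - theta) * a k + L k w) / (1 + al * theta * a k.+1)).
  rewrite (theta_method_prod dt0 kl0 th0 hX); congr (_ * _).
  by apply: eq_bigr => k _; congr (_ / _); rewrite /al /a /L /V /t /p; ring.
pose tail k w := expR (- (x k ^+ 2 / v)) *
   (expR (x k / v * L k.+1 w) + expR (- (x k / v) * L k.+1 w)).
have tail0 k w : 0 <= tail k w by rewrite mulr_ge0 ?addr_ge0 ?expR_ge0.
have mL k : measurable_fun setT (L k).
  by have [iL _ _ _] := Lfact k; apply/measurable_EFinP; exact: measurable_int iL.
have mtail k : measurable_fun setT (tail k).
  apply: measurable_funM => //; apply: measurable_funD;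
    by apply: measurableT_comp => //; exact: measurable_funM.
have tail1 k w : x k < `|L k.+1 w| -> 1 <= tail k w.
  move=> xL; have e1 : 1 <= expR (- (x k ^+ 2 / v)) * expR (x k / v * `|L k.+1 w|).
    rewrite -expRD -[leLHS]expR0 ler_expR addrC subr_ge0 expr2 mulrAC.
    by rewrite ler_wpM2l ?divr_ge0 ?ltW.
  apply: le_trans e1 _; rewrite ler_wpM2l ?expR_ge0//.
  case: (leP 0 (L k.+1 w)) => [L0|L0].
    by rewrite ger0_norm// lerDl expR_ge0.
  by rewrite ltr0_norm// mulrN mulNr lerDr expR_ge0.
(* A pathwise union bound: either some noise passes its threshold and its [tail] is at least 1, or
   every ratio is large and [X m.+1 ^+ 2] is at least [c]. *)
have pointwise m w : 0 <= L 0%N w ->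
    1 <= X m.+1 w ^+ 2 / c + \sum_(k < m) tail k w.
  move=> L0; have [hall|] := pselect (forall k : 'I_m, `|L k.+1 w| <= x k); last first.
    move=> /existsNP[k /negP]; rewrite -ltNge => /tail1 h.
    rewrite (bigD1 k)//=; apply: le_trans h _.
    rewrite addrCA lerDl addr_ge0 ?sumr_ge0//.
    by rewrite divr_ge0 ?sqr_ge0// ltW.
  apply: (@le_trans _ _ (X m.+1 w ^+ 2 / c)); last by rewrite lerDl sumr_ge0.
  rewrite ler_pdivlMr// mul1r /c -[leRHS]real_normK ?num_real//.
  rewrite lerXn2r ?nnegrE ?mulr_ge0 ?invr_ge0 ?(ltW D00) ?(ltW c30)//.
  rewrite XE big_ord_recl/= !normrM -[leLHS]mulrA ler_wpM2l//.
  apply: ler_pM; rewrite ?invr_ge0 ?(ltW D00) ?(ltW c30)//.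
    (* The first factor is thus [(1 + L 0) / D0], at least [1 / D0] when [L 0 >= 0]. *)
    have -> : a 0%N = 0 by rewrite aE powR0 ?mul0r// gt_eqF.
    rewrite mulr0 subr0 normfV (gtr0_norm D00) -[leLHS]mul1r.
    rewrite ler_wpM2r ?invr_ge0 ?(ltW D00)//.
    by rewrite ger0_norm ?addr_ge0// lerDl.
  rewrite normr_prod.
  (* The ratios [a k.+1 / a k.+2] telescope to an inverse power of [m.+1], which the growth [g ^+ m]
     outweighs. *)
  apply: (@le_trans _ _ (\prod_(k < m) (g * (a k.+1 / a k.+2)))).
    rewrite big_split/= prodr_const card_ord.
    have -> : \prod_(k < m) (a k.+1 / a k.+2) = (m.+1%:R `^ p)^-1.
      elim: (m) => [|j IH]; first by rewrite big_ord0 powR1 invr1.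
      rewrite big_ord_recr/= IH !aE; field.
      by rewrite !gt_eqF ?powR_gt0.
    by rewrite ler_pdivlMr ?powR_gt0.
  apply: ler_prod => k _; rewrite mulr_ge0 ?divr_ge0 ?(ltW (a0 _)) ?(le_trans ler01 (ltW g1))//=.
  exact: (theta_ratio_ge th0 (a0 _) (aS _) al0 g1 (big k) (hall k)).
have tail_le k : (\int[P]_w (tail k w)%:E <=
    (2 * expR (- Y) * k.+1%:R ^- 2)%:E)%E.
  have [iL L0 gL L2] := Lfact k.+1.
  apply: le_trans (centered_gaussian_tail (x k) iL L0 gL L2 v0) _.
  rewrite lee_fin YE -mulrA ler_wpM2l//; apply: expR_powR_le_inv_sqr.
  - lra.
  - by rewrite mulr_ge0// ltW.
  - rewrite (@le_trans _ _ (p^-1 * (2 * p)))//.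
      by rewrite mulrCA mulVf ?gt_eqF// mulr1.
    by rewrite ler_wpM2r ?mulr_ge0 ?(ltW p0)//; lra.
have sum_tail m : (\sum_(k < m) \int[P]_w (tail k w)%:E <= (4^-1)%:E)%E.
  apply: (@le_trans _ _ (\sum_(k < m) (2 * expR (- Y) * k.+1%:R ^- 2)%:E)%E).
    by apply: lee_sum => k _; exact: tail_le.
  rewrite sumEFin lee_fin -mulr_sumr.
  have S2 : \sum_(k < m) (k.+1%:R ^- 2 : R) <= 2.
    by apply: le_trans (sum_inv_sqr_le m) _; rewrite gerBl invr_ge0.
  apply: le_trans (ler_wpM2l _ S2) _; first by rewrite mulr_ge0 ?expR_ge0.
  rewrite expRN mulrAC -[leRHS]mul1r ler_pdivrMr ?expR_gt0//.
  by have := expR_ge1Dx Y; lra.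
have mX n : measurable_fun setT (fun w => (X n w ^+ 2)%:E).
  by apply/measurable_EFinP; exact: measurable_funX.
(* As [0 <= L 0] has probability at least [1/2], integrating [pointwise] gives [1/2 <= E / c + 1/4]
   for the second moment [E]. *)
have lower m : ((c / 4)%:E <= 'E_P[fun w => (`|X m.+1 w| ^+ 2)%R])%E.
  have [iL L0 gL _] := Lfact 0%N.
  have half := centered_gaussian_half iL L0 gL.
  have mS : measurable [set w | 0 <= L 0%N w].
    rewrite -[X in measurable X]setTI.
    have -> : [set w | 0 <= L 0%N w] = L 0%N @^-1` `[0, +oo[%classic.
      by apply/seteqP; split => w /=; rewrite in_itv/= andbT.
    exact: mL.
  have key : (P [set w | (0 <= L 0%N w)%R] <=
      c^-1%:E * 'E_P[fun w => (`|X m.+1 w| ^+ 2)%R] +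
      \sum_(k < m) \int[P]_w (tail k w)%:E)%E.
    rewrite unlock; under eq_integral do rewrite real_normK ?num_real//.
    rewrite -ge0_integralZl//; last 2 first.
    - by move=> w _; rewrite lee_fin sqr_ge0.
    - by rewrite lee_fin invr_ge0 ltW.
    rewrite -ge0_integral_sum//; last 2 first.
    - by move=> k; apply/measurable_EFinP.
    - by move=> k w _; rewrite lee_fin.
    rewrite -ge0_integralD//; last 4 first.
    - by move=> w _; rewrite mule_ge0 ?lee_fin ?invr_ge0 ?sqr_ge0 ?ltW.
    - exact: emeasurable_funM.
    - by move=> w _; apply: sume_ge0 => k _; rewrite lee_fin.
    - by apply: emeasurable_sum => k; exact/measurable_EFinP.
    have -> : P [set w | 0 <= L 0%N w] =
        (\int[P]_w (\1_[set w | 0 <= L 0%N w] w)%:E)%E.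
      by rewrite integral_indic// setIT.
    apply: ge0_le_integral => //.
    - exact/measurable_EFinP/measurable_indic.
    - apply: emeasurable_funD; first exact: emeasurable_funM.
      by apply: emeasurable_sum => k; exact/measurable_EFinP.
    - move=> w _; rewrite sumEFin -EFinM -EFinD lee_fin indicE.
      case: (boolP (w \in _)) => [|_].
        by rewrite inE/= => /(pointwise m w); rewrite mulrC.
      by rewrite addr_ge0 ?sumr_ge0// mulr_ge0 ?invr_ge0 ?sqr_ge0// ltW.
  have := le_trans half (le_trans key (leeD2l _ (sum_tail m))).
  case: ('E_P[_])%E => [e| |].
  - rewrite -EFinM -EFinD !lee_fin mulrC -lerBlDr ler_pdivlMr// mulrC.
    by apply: le_trans; rewrite ler_wpM2l ?(ltW c0)//; lra.
  - by rewrite leey.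
  - by rewrite gt0_muleNy ?lte_fin ?invr_gt0.
have stab := stable dt dt0 X hX.
have : ((c / 4)%:E <= 0)%E.
  rewrite -(cvg_lim (@ereal_hausdorff _) stab); apply: lime_ge; first exact: cvgP stab.
  near=> n; have n0 : (0 < n)%N by near: n; exact: nbhs_infty_gt.
  by rewrite -(prednK n0).
by rewrite leNgt lte_fin divr_gt0.
Unshelve. all: by end_near. Qed.

End instability.

Theorem theorem1p1 (d : measure_display) (T : measurableType d) (R : realType)
    (P : probability T R) (H : R) (hH : 2^-1 < H) (hH1 : H < 1)
    (B : R -> {RV P >-> R}) (hB : fractional_brownian_motion H B)
    (X0 : R) (hX0 : X0 != 0) (kappa lambda mu : R) (hkappa : 2 * H <= kappa)
    (hab : (2 * H < kappa /\ 0 < lambda) \/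
           (kappa = 2 * H /\ - lambda + mu ^+ 2 < 0)) :
  [/\ (forall theta : R,
         Num.sqrt (3 / 2) * expR 1 / (Num.sqrt (3 / 2) * expR 1 + 1) <= theta ->
         theta <= 1 ->
         unconditionally_mean_square_stable B X0 kappa lambda mu theta),
      (3 / 2 < kappa ->
       forall theta : R, 2^-1 < theta -> theta <= 1 ->
         unconditionally_mean_square_stable B X0 kappa lambda mu theta) &
      (forall theta : R, 0 < theta -> theta < 2^-1 ->
         ~ unconditionally_mean_square_stable B X0 kappa lambda mu theta)].
Proof.
(* In case (b), [mu ^+ 2 < lambda] forces [lambda > 0]. *)
have lambda0 : 0 < lambda.
  by case: hab => [[] //|[_]]; have := sqr_ge0 mu; lra.
split=> [theta th th1|_ theta th th1|theta th0 th1].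
- apply: (theta_method_stable hH hB) => //; apply: lt_le_trans th.
  (* The quotient [s / (s + 1)] exceeds [1/2] once [s > 1]; crude bounds on the two factors of [s]
     give [s >= 2]. *)
  have s1 : 1 <= Num.sqrt (3 / 2) :> R by rewrite -[leLHS]sqrtr1 ler_wsqrtr//; lra.
  have e2 : 2 <= expR 1 :> R by have := @expR_ge1Dx R 1; lra.
  have se : 2 <= Num.sqrt (3 / 2) * expR 1 :> R.
    by rewrite -[leLHS]mul1r ler_pM.
  rewrite ltr_pdivlMr; last by lra.
  by lra.
- exact: (theta_method_stable hH hB).
- exact: (theta_method_unstable hH hB).
Qed.
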